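(* Let $\mathcal{M}$ be a family of distributions on $\mathcal{W}$. For any measurable loss $\ell$ and any algorithm $\mathsf{A}$ run on $S'\sim(\mu')^{\otimes n}$ such that the marginal distribution of $\mathsf{A}(S')$ belongs to $\mathcal{M}$, \[ \mathrm{gen}(\mu,\mu',\mathsf{A})\ge\mathsf{D}_4\!\left(\frac{I(S';\mathsf{A}(S'))}{n},\mathcal{M}\right), \] where \[ \mathsf{D}_4(r,\mathcal{M})\triangleq\inf_{\nu\in\mathcal{M}}\ \inf_{\substack{P_{\hat W,Z'}\in U(\nu,\mu'):\\ I(\hat W;Z')\le r}}\mathbb{E}\big[L_\mu(\hat W)-\ell(\hat W,Z')\big], \] with $U(\nu,\mu')$ the set of couplings of $\nu$ (on $\mathcal{W}$) and $\mu'$ (on $\mathcal{Z}$).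
   Context: Setup: $\mathcal{Z},\mathcal{W}$ measurable spaces, $\ell:\mathcal{W}\times\mathcal{Z}\to[0,\infty)$ measurable loss, $\mu$ (test) and $\mu'$ (training) distributions on $\mathcal{Z}$, $S'=(Z'_1,\dots,Z'_n)$ i.i.d. $\sim\mu'$, $\mathsf{A}$ a Markov kernel from $\mathcal{Z}^n$ to $\mathcal{W}$, $W'=\mathsf{A}(S')$, $L_\mu(w)=\mathbb{E}_{Z\sim\mu}\ell(w,Z)$, $L_s(w)=\frac1n\sum_i\ell(w,z_i)$, $\mathrm{gen}(\mu,\mu',\mathsf{A})=\mathbb{E}[L_\mu(W')-L_{S'}(W')]$. All expectations assumed finite. *)

(* Defs.v *)
From HB Require Import structures.
From mathcomp Require Import all_boot all_order all_algebra.
From mathcomp Require Import all_classical all_reals all_analysis.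
Set Implicit Arguments.
Unset Strict Implicit.
Unset Printing Implicit Defensive.
Import Order.TTheory GRing.Theory Num.Theory.
Local Open Scope classical_set_scope.
Local Open Scope ring_scope.
Local Open Scope ereal_scope.

Section defs.
Context (R : realType).

(** Kullback-Leibler divergence (in nats) of P with respect to Q:
    if P has a density f = dP/dQ, KL(P||Q) = E_P[ln f]; otherwise +oo.
    All densities agree Q-a.e. (hence P-a.e.), so the infimum below is over a
    set of equal values when P << Q, and is the infimum of the empty set
    (= +oo) when P has no density w.r.t. Q. *)
Definition is_density d (T : measurableType d) (P Q : set T -> \bar R)
    (f : T -> R) : Prop :=
  [/\ measurable_fun [set: T] f, (forall x, (0 <= f x)%R) &
      forall A, measurable A -> P A = \int[Q]_(x in A) (f x)%:E].

Definition KL d (T : measurableType d) (P Q : set T -> \bar R) : \bar R :=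
  ereal_inf [set \int[P]_x (ln (f x))%:E | f in is_density P Q].

Definition jointk d1 d2 (X : measurableType d1) (Y : measurableType d2)
    (m1 : set X -> \bar R) (k : X -> set Y -> \bar R) : set (X * Y) -> \bar R :=
  fun E => \int[m1]_x k x (xsection E x).

Definition prodm d1 d2 (X : measurableType d1) (Y : measurableType d2)
    (m1 : set X -> \bar R) (m2 : set Y -> \bar R) : set (X * Y) -> \bar R :=
  jointk m1 (fun _ => m2).

Definition mutual_info d1 d2 (X : measurableType d1) (Y : measurableType d2)
    (pi : set (X * Y) -> \bar R) : \bar R :=
  KL pi (prodm (pushforward pi fst) (pushforward pi snd)).

(** Law of S' = n i.i.d. samples from mu' (product measure mu'^{(x) n}),
    characterized on measurable rectangles. *)
Definition iid_law d (Z : measurableType d) (n : nat)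
    (mu' : set Z -> \bar R) (P : set (n.-tuple Z) -> \bar R) : Prop :=
  forall B : 'I_n -> set Z, (forall i, measurable (B i)) ->
    P [set s | forall i, B i (tnth s i)] = \prod_(i < n) mu' (B i).

Definition coupling dW dZ (W : measurableType dW) (Z : measurableType dZ)
    (nu : set W -> \bar R) (mu' : set Z -> \bar R)
    (pi : set (W * Z) -> \bar R) : Prop :=
  (forall B, measurable B -> pi (B `*` [set: Z]) = nu B) /\
  (forall C, measurable C -> pi ([set: W] `*` C) = mu' C).

Definition pop_risk dW dZ (W : measurableType dW) (Z : measurableType dZ)
    (l : W -> Z -> R) (mu : set Z -> \bar R) (w : W) : \bar R :=
  \int[mu]_z (l w z)%:E.

Definition emp_risk dW dZ (W : measurableType dW) (Z : measurableType dZ)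
    (n : nat) (l : W -> Z -> R) (s : n.-tuple Z) (w : W) : R :=
  (n%:R^-1 * \sum_(i < n) l w (tnth s i))%R.

Definition train_joint dZ dW (Z : measurableType dZ) (W : measurableType dW)
    (n : nat) (P : set (n.-tuple Z) -> \bar R)
    (A : R.-pker (n.-tuple Z) ~> W) : set (n.-tuple Z * W) -> \bar R :=
  jointk P (fun s B => A s B).

Definition out_law dZ dW (Z : measurableType dZ) (W : measurableType dW)
    (n : nat) (P : set (n.-tuple Z) -> \bar R)
    (A : R.-pker (n.-tuple Z) ~> W) : set W -> \bar R :=
  fun B => \int[P]_s A s B.

Definition gen dZ dW (Z : measurableType dZ) (W : measurableType dW)
    (n : nat) (l : W -> Z -> R) (mu : set Z -> \bar R)
    (P : set (n.-tuple Z) -> \bar R) (A : R.-pker (n.-tuple Z) ~> W) :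
    \bar R :=
  \int[train_joint P A]_p (pop_risk l mu p.2 - (emp_risk l p.1 p.2)%:E).

Definition D4 dW dZ (W : measurableType dW) (Z : measurableType dZ)
    (l : W -> Z -> R) (mu mu' : set Z -> \bar R)
    (r : \bar R) (M : set (probability W R)) : \bar R :=
  ereal_inf [set v | exists (nu : probability W R) (pi : probability (W * Z)%type R),
    [/\ M nu, coupling nu mu' pi, mutual_info pi <= r &
        v = \int[pi]_p (pop_risk l mu p.1 - (l p.1 p.2)%:E)]].

End defs.

(* Main.v *)
Require Import Defs.
From HB Require Import structures.
From mathcomp Require Import all_boot all_order all_algebra.
From mathcomp Require Import all_classical all_reals all_analysis.
From mathcomp Require Import measurable_realfun lra.
Import Order.TTheory GRing.Theory Num.Theory.
Local Open Scope classical_set_scope.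
Local Open Scope ring_scope.
Local Open Scope ereal_scope.

(** Let [J] be the law of [(S', W')], [nu] its second marginal, and take for
    coupling the uniform mixture [p] over [i] of the laws of [(W', Z'_i)], which
    has marginals [nu] and [mu'] and turns the objective of [D4] into [gen].
    To bound its mutual information, let [g] be the density of [p] with respect
    to [nu \x mu'], and [f] that of [J] with respect to [P \x nu].  By
    independence, [G (s, w) = \prod_i g (w, s_i)] has integral [1] against
    [P \x nu], so integrating [ln G <= ln f + G / f - 1] against [J] (Gibbs'
    inequality) yields [n * KL p (nu \x mu') <= KL J (P \x nu)] in one step,
    without separate superadditivity and convexity arguments.  Positive and
    negative parts of the logarithms are kept apart since the former may fail
    to be integrable. *)

(** * Integration against the image of a weighted measure *)

Import HBNNSimple.

(** Both sides are monotone limits along simple approximations of [h], and by linearity the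
    indicator case is the hypothesis on [m]. Taking [phi] to be the identity gives the usual change
    of measure; taking a coordinate map gives the i.i.d. induction step. *)
Lemma ge0_integral_pushforward_density {R : realType} {d1 d2 : measure_display}
    {X : measurableType d1} {Y : measurableType d2}
    (m : {measure set Y -> \bar R}) (Q : {measure set X -> \bar R})
    (phi : X -> Y) (G : X -> R) (h : Y -> \bar R) :
  measurable_fun [set: X] phi -> measurable_fun [set: X] G ->
  (forall x, (0 <= G x)%R) ->
  (forall C, measurable C -> m C = \int[Q]_(x in phi @^-1` C) (G x)%:E) ->
  measurable_fun [set: Y] h -> (forall y, 0 <= h y) ->
  \int[m]_y h y = \int[Q]_x (h (phi x) * (G x)%:E).
Proof.
move=> mphi mG G0 mE mh h0.
have mEG : measurable_fun [set: X] (EFin \o G) by exact/measurable_EFinP.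
pose h_ := nnsfun_approx measurableT mh.
have -> : \int[m]_y h y = limn (fun k => \int[m]_y (EFin \o h_ k) y).
  rewrite -monotone_convergence//.
  - apply: eq_integral => y _; apply/esym/cvg_lim => //.
    exact: cvg_nnsfun_approx.
  - by move=> k; exact/measurable_EFinP/measurable_funP.
  - by move=> k y _; rewrite lee_fin.
  - by move=> y _ a b ab; rewrite lee_fin; exact/lefP/nd_nnsfun_approx.
have -> : \int[Q]_x (h (phi x) * (G x)%:E) =
    limn (fun k => \int[Q]_x ((h_ k (phi x))%:E * (G x)%:E)).
  rewrite -monotone_convergence//.
  - apply: eq_integral => x _; apply/esym/cvg_lim => //.
    by apply: cvgeZr => //; exact: cvg_nnsfun_approx.
  - move=> k; apply: emeasurable_funM => //; apply/measurable_EFinP.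
    by apply: measurableT_comp => //; exact/measurable_funP.
  - by move=> k x _; rewrite mule_ge0 ?lee_fin.
  - move=> x _ a b ab; rewrite lee_wpmul2r ?lee_fin//.
    exact/lefP/nd_nnsfun_approx.
congr (limn _); apply/funext => k.
have mpre r : measurable (phi @^-1` (h_ k @^-1` [set r])).
  by rewrite -[X in measurable X]setTI; exact: mphi.
transitivity (\int[m]_y
   (\sum_(r \in range (h_ k)) (r * \1_(h_ k @^-1` [set r]) y)%:E)).
  by apply: eq_integral => y _; rewrite /= fimfunE -fsumEFin.
rewrite ge0_integral_fsum//; last 2 first.
- by move=> r; exact/measurable_EFinP/measurable_funM.
- by move=> r y _; exact: nnfun_muleindic_ge0.
transitivity (\int[Q]_x (\sum_(r \in range (h_ k))
    (r * \1_(h_ k @^-1` [set r]) (phi x))%:E * (G x)%:E)); last first.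
  apply: eq_integral => x _.
  rewrite -ge0_mule_fsuml => [|y]; last exact: nnfun_muleindic_ge0.
  by rewrite fsumEFin// -(fimfunE _ (phi x)).
have mind r : measurable_fun [set: X]
    (fun x => (\1_(h_ k @^-1` [set r]) (phi x))%:E * (G x)%:E).
  apply: emeasurable_funM => //; apply/measurable_EFinP.
  exact: measurableT_comp.
rewrite ge0_integral_fsum//; last 2 first.
- move=> r; under eq_fun do rewrite EFinM -muleA.
  exact: measurable_funeM.
- by move=> r x _; apply: mule_ge0; rewrite ?lee_fin//; exact: nnfun_muleindic_ge0.
apply: eq_fsbigr => r rhn.
under [LHS]eq_integral do rewrite EFinM.
rewrite integralZl_indic_nnsfun => //.
under [RHS]eq_integral do rewrite EFinM -muleA.
rewrite ge0_integralZl//; last 2 first.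
- by move=> x _; rewrite mule_ge0 ?lee_fin.
- by move: rhn; rewrite inE => -[t _ <-]; rewrite lee_fin.
rewrite integral_indic// setIT mE//; congr (_ * _).
rewrite integral_mkcond; apply: eq_integral => x _.
by rewrite muleC epatch_indic.
Qed.

(** * Products of functions of i.i.d. coordinates *)

Lemma measurable_tuple_rectangle {d : measure_display} {Z : measurableType d}
    {n : nat} (B : 'I_n -> set Z) : (forall i, measurable (B i)) ->
  measurable [set s : n.-tuple Z | forall i, B i (tnth s i)].
Proof.
move=> mB.
have -> : [set s : n.-tuple Z | forall i, B i (tnth s i)] =
    \big[setI/setT]_(i < n) ((fun s : n.-tuple Z => tnth s i) @^-1` B i).
  rewrite -bigcap_seq; apply/seteqP; split => s /= Hs i.
    by move=> _; exact: Hs.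
  by apply: Hs; rewrite /= mem_index_enum.
apply: bigsetI_measurable => i _; rewrite -[X in measurable X]setTI.
exact: measurable_tnth.
Qed.

Lemma prod_indic_tuple {R : realType} {Z : Type} {n : nat}
    (B : 'I_n -> set Z) (s : n.-tuple Z) :
  (\prod_(i < n) \1_(B i) (tnth s i) =
   \1_[set s : n.-tuple Z | forall i, B i (tnth s i)] s :> R)%R.
Proof.
rewrite [RHS]indicE; case: (pselect (forall i, B i (tnth s i))) => Bs.
  by rewrite mem_set// big1// => i _; rewrite indicE mem_set.
rewrite memNset//; have /existsNP[i Bi] := Bs.
by rewrite (bigD1 i)//= indicE memNset// mul0r.
Qed.

(* The indicators of a rectangle are replaced by [h] one coordinate at a time. *)
Lemma iid_integral_prod_eq1 {R : realType} {d : measure_display}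
    {Z : measurableType d} {n : nat} (mu' : probability Z R)
    (P : probability (n.-tuple Z) R) (h : Z -> R) :
  iid_law mu' P -> measurable_fun [set: Z] h -> (forall z, (0 <= h z)%R) ->
  \int[mu']_z (h z)%:E = 1 ->
  \int[P]_s (\prod_(i < n) h (tnth s i))%:E = 1.
Proof.
move=> iid mh h0 h1.
(* The first [k] factors are already [h], the others still indicators; [v] lists the expected
   integrals of the factors, 1 being that of [h]. *)
pose F k (B : 'I_n -> set Z) (i : 'I_n) (z : Z) : R :=
  if (i < k)%N then h z else \1_(B i) z.
pose v k (B : 'I_n -> set Z) (i : 'I_n) : R :=
  if (i < k)%N then 1%R else fine (mu' (B i)).
have F0 k B i z : (0 <= F k B i z)%R by rewrite /F; case: ifP.
have v0 k B i : (0 <= v k B i)%R.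
  by rewrite /v; case: ifP => // _; rewrite fine_ge0.
have mF k B i : (forall i, measurable (B i)) ->
    measurable_fun [set: n.-tuple Z] (fun s => F k B i (tnth s i)).
  move=> mB; have [ik|ik] := boolP (i < k)%N; rewrite /F ?ik ?(negbTE ik);
    (apply: measurableT_comp; last exact: measurable_tnth) => //.
(* The sides [B] stay universally quantified because the induction step changes one of them. *)
suff H k B : (k <= n)%N -> (forall i, measurable (B i)) ->
    \int[P]_s (\prod_(i < n) F k B i (tnth s i))%:E = (\prod_(i < n) v k B i)%:E.
  have := H n (fun=> setT) (leqnn n) (fun=> measurableT).
  rewrite [X in _ = X%:E]big1 => [|i _]; last by rewrite /v ltn_ord.
  move=> <-; apply: eq_integral => s _; congr (_%:E).
  by apply: eq_bigr => i _; rewrite /F ltn_ord.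
elim: k B => [|k IH] B kn mB.
  under eq_integral do rewrite prod_indic_tuple.
  rewrite integral_indic//; last exact: measurable_tuple_rectangle.
  rewrite setIT [LHS](iid B mB) (big_morph EFin (@EFinM R) erefl).
  by apply: eq_bigr => i _; rewrite fineK// fin_num_measure.
pose j := Ordinal kn.
pose G (s : n.-tuple Z) := (\prod_(i < n | i != j) F k B i (tnth s i))%R.
have G0 s : (0 <= G s)%R by apply: prodr_ge0 => i _.
have mG : measurable_fun [set: n.-tuple Z] G.
  rewrite /G; under eq_fun do rewrite big_mkcond.
  apply: measurable_prod => i _; case: (i != j) => //.
  exact: mF.
have c0 : (0 <= \prod_(i < n | i != j) v k B i)%R by apply: prodr_ge0 => i _.
pose c := NngNum c0.
have Gj s : (\prod_(i < n) F k.+1 B i (tnth s i) = h (tnth s j) * G s)%R.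
  rewrite (bigD1 j)//= {1}/F/= ltnS leqnn; congr (_ * _)%R.
  apply: eq_bigr => i ij; rewrite /F ltnS leq_eqVlt.
  by case: eqP => // ik; move: ij; rewrite -val_eqE/= ik eqxx.
have -> : (\prod_(i < n) v k.+1 B i = \prod_(i < n | i != j) v k B i)%R.
  rewrite (bigD1 j)//= {1}/v/= ltnS leqnn mul1r.
  apply: eq_bigr => i ij; rewrite /v ltnS leq_eqVlt.
  by case: eqP => // ik; move: ij; rewrite -val_eqE/= ik eqxx.
under eq_integral do rewrite Gj EFinM.
(* The remaining factors [G] serve as a weight on [P]: the image of the weighted measure under
   coordinate [j] is [c] times [mu'], so [h] can be integrated there. *)
rewrite -(@ge0_integral_pushforward_density _ _ _ _ _ (mscale c mu') P
  (fun s => tnth s j) G (EFin \o h))//.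
- rewrite ge0_integral_mscale//=; first by rewrite h1 mule1.
  + exact/measurable_EFinP.
  + by move=> z _; rewrite lee_fin.
- exact: measurable_tnth.
(* Since [j] has index [k], the induction hypothesis still has an indicator at [j], and side [j] may
   be chosen to be [C]. *)
- move=> C mC; pose B' i := if i == j then C else B i.
  have mB' i : measurable (B' i) by rewrite /B'; case: ifP.
  have := IH B' (ltnW kn) mB'.
  have vj : v k B' j = fine (mu' C) by rewrite /v /B' /= ltnn eqxx.
  have Fj z : F k B' j z = \1_C z by rewrite /F /B' /= ltnn eqxx.
  rewrite (bigD1 j)//= vj => H.
  transitivity (fine (mu' C) * \prod_(i < n | i != j) v k B i)%:E.
    by rewrite EFinM fineK ?fin_num_measure// muleC.
  transitivity (fine (mu' C) * \prod_(i < n | i != j) v k B' i)%:E.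
    congr (_ * _)%:E; apply: eq_bigr => i ij.
    by rewrite /v /B' (negbTE ij).
  rewrite -H [RHS]integral_mkcond; apply: eq_integral => s _.
  rewrite epatch_indic (bigD1 j)//= Fj mulrC EFinM.
  congr (_%:E * _); apply: eq_bigr => i ij.
  by rewrite /F /B' (negbTE ij).
- exact/measurable_EFinP.
Qed.

(** * Joint laws and mixtures as bundled measures *)

(** Gives the bare set function [train_joint] the structure that integration lemmas require.
    Countable additivity is that of each [k x] on sections, exchanged with the integral over [m]. *)
Lemma jointk_probability {R : realType} {d1 d2 : measure_display}
    {X : measurableType d1} {Y : measurableType d2}
    (m : probability X R) (k : R.-pker X ~> Y) :
  exists J : probability (X * Y)%type R,
    (J : set (X * Y) -> \bar R) = jointk m (fun x B => k x B).
Proof.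
pose J0 : set (X * Y) -> \bar R := jointk m (fun x B => k x B).
have J0_0 : J0 set0 = 0.
  by rewrite [LHS]integral0_eq// => x/= _; rewrite xsection0.
have J0_ge0 A : 0 <= J0 A by apply: integral_ge0.
have J0_sigma : semi_sigma_additive J0.
  move=> F mF tF mUF.
  rewrite [X in _ --> X](_ : _ = \sum_(n <oo) J0 (F n)).
    by apply/cvg_closeP; split; [exact: is_cvg_nneseries|rewrite closeE].
  rewrite -integral_nneseries//; last first.
    by move=> n; apply: measurable_fun_xsection_finite_kernel; rewrite inE.
  apply: eq_integral => x _; apply/esym/cvg_lim => //=; rewrite xsection_bigcup.
  apply: (measure_sigma_additive _ (trivIset_xsection tF)) => ?.
  exact: measurable_xsection.
have J0_T : J0 setT = 1.
  rewrite /J0 /jointk.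
  under eq_integral do rewrite xsectionE preimage_setT prob_kernel.
  by rewrite integral_cst//= mul1e probability_setT.
pose mJ := isMeasure.Build _ _ _ J0 J0_0 J0_ge0 J0_sigma.
pose J1 : {measure set (X * Y) -> \bar R} := HB.pack J0 mJ.
pose pJ := Measure_isProbability.Build _ _ _ J1 J0_T.
pose J : probability (X * Y)%type R := HB.pack J0 mJ pJ.
by exists J.
Qed.

Lemma exists_pushforward_measure {R : realType} {d1 d2 : measure_display}
    {X : measurableType d1} {Y : measurableType d2}
    (m : {measure set X -> \bar R}) (f : X -> Y) :
  measurable_fun [set: X] f ->
  {m' : {measure set Y -> \bar R} | m' = pushforward m f :> (_ -> _)}.
Proof.
move=> mf; unshelve eexists.
  by refine [the {measure set Y -> \bar R} of pushforward m f]; exact: mf.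
by [].
Qed.

Lemma uniform_mixture_pushforward {R : realType} {d1 d2 : measure_display}
    {X : measurableType d1} {Y : measurableType d2} {n : nat}
    (J : probability X R) (phi : 'I_n -> X -> Y) :
  (0 < n)%N -> (forall i, measurable_fun [set: X] (phi i)) ->
  exists2 p : probability Y R,
    forall E, p E = (n%:R^-1)%:E * \sum_(i < n) J (phi i @^-1` E) &
    forall h : Y -> \bar R, measurable_fun [set: Y] h -> (forall y, 0 <= h y) ->
      \int[p]_y h y = (n%:R^-1)%:E * \sum_(i < n) \int[J]_x h (phi i x).
Proof.
move=> n0 mphi; pose i0 := Ordinal n0.
pose pf i := exists_pushforward_measure J (phi i) (mphi i).
(* [msum] takes a family indexed by all naturals; indices from [n] on receive the default [i0] and
   do not enter the sum. *)
pose m k : {measure set Y -> \bar R} := sval (pf (insubd i0 k)).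
have mE (i : 'I_n) : (m i : set Y -> \bar R) = pushforward J (phi i).
  by rewrite /m valKd; exact: svalP (pf i).
have c0 : (0 <= n%:R^-1 :> R)%R by rewrite invr_ge0.
pose M : {measure set Y -> \bar R} := mscale (NngNum c0) (msum m n).
have ME E : M E = (n%:R^-1)%:E * \sum_(i < n) J (phi i @^-1` E).
  by rewrite /M/= /mscale/= /msum; congr (_ * _); apply: eq_bigr => i _; rewrite mE.
have MT : M setT = 1.
  rewrite ME; under eq_bigr do rewrite preimage_setT probability_setT.
  rewrite sumEFin big_const_ord iter_addr_0 -EFinM mulVf//.
  by rewrite pnatr_eq0 -lt0n.
pose pM := Measure_isProbability.Build _ _ _ M MT.
pose p : probability Y R := HB.pack (Measure.sort M) (Measure.class M) pM.
exists p => // h mh h0.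
rewrite [LHS](_ : _ = \int[M]_y h y)// ge0_integral_mscale//; congr (_ * _).
rewrite ge0_integral_measure_sum//; apply: eq_bigr => i _.
by rewrite mE ge0_integral_pushforward// => ? _.
Qed.

(** * Densities and the product of the marginals *)

Lemma ge0_integral_density {R : realType} {d : measure_display}
    {T : measurableType d} (p q : {measure set T -> \bar R}) (f : T -> R)
    (h : T -> \bar R) : is_density p q f ->
  measurable_fun [set: T] h -> (forall x, 0 <= h x) ->
  \int[p]_x h x = \int[q]_x (h x * (f x)%:E).
Proof.
case=> mf f0 pE mh h0.
by apply: (@ge0_integral_pushforward_density _ _ _ _ _ p q id).
Qed.

(** An integral sees its measure only through the level sets of simple functions, which are
    measurable. This matters because [prodm] is built from bare set functions. *)
Lemma eq_setfun_integral {R : realType} {d : measure_display}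
    {T : measurableType d} (m1 m2 : set T -> \bar R) (D : set T)
    (f : T -> \bar R) : (forall A, measurable A -> m1 A = m2 A) ->
  \int[m1]_(x in D) f x = \int[m2]_(x in D) f x.
Proof.
move=> m12.
have E : sintegral m1 = sintegral m2 :> ({nnsfun T >-> R} -> _).
  by apply/funext => h; apply: eq_fsbigr => r _; rewrite m12.
rewrite /integral; congr (ereal_sup _ - ereal_sup _);
  by apply/seteqP; split => _ [h hf <-]; exists h => //;
    have := congr1 (fun F => F h) E.
Qed.

Lemma eq_is_density {R : realType} {d : measure_display} {T : measurableType d}
    (p q q' : set T -> \bar R) :
  (forall A, measurable A -> q A = q' A) -> is_density p q = is_density p q'.
Proof.
move=> qq'; apply/funext => f; apply/propext.
by split=> -[mf f0 pE]; split => // A mA; rewrite pE//;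
  apply: eq_setfun_integral => B mB; rewrite qq'.
Qed.

(** The [p]-mass of the zero set of [f] is the integral of [f] over it, hence 0. So the value of
    [ln] at 0 has no effect under [p]. *)
Lemma ae_density_gt0 {R : realType} {d : measure_display}
    {T : measurableType d} (p q : {measure set T -> \bar R}) (f : T -> R) :
  is_density p q f -> {ae p, forall x, (0 < f x)%R}.
Proof.
move=> [mf f0 pE].
have mf0 : measurable (f @^-1` [set 0%R]).
  by rewrite -[X in measurable X]setTI; exact: mf.
exists (f @^-1` [set 0%R]); split => //.
  by rewrite pE// integral0_eq// => x /= ->.
move=> x /= /negP; rewrite lt_neqAle f0 andbT negbK => /eqP; exact: esym.
Qed.

(** Radon-Nikodym: the derivative is finite everywhere, so [fine] turns it into a real-valued
    density without loss. *)
Lemma exists_density {R : realType} {d : measure_display}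
    {T : measurableType d} (p : {finite_measure set T -> \bar R})
    (q : {sigma_finite_measure set T -> \bar R}) :
  (forall A, measurable A -> q A = 0 -> p A = 0) -> exists g, is_density p q g.
Proof.
move=> pq; have /null_content_dominatesP : content_dominates q p by [].
move=> /radon_nikodym_sigma_finite[g [g0 gfin gint pE]].
exists (fine \o g); split => [|x|A mA].
- by apply: measurableT_comp => //; exact: measurable_int gint.
- by rewrite fine_ge0.
- by rewrite pE//; apply: eq_integral => x _ /=; rewrite fineK.
Qed.

(** Passes from the set function [prodm] to a genuine product measure, to which Radon-Nikodym and
    Fubini apply; the two agree on measurable sets, since sections are measurable. *)
Lemma mutual_infoE {R : realType} {d1 d2 : measure_display}
    {X : measurableType d1} {Y : measurableType d2}
    (J : probability (X * Y)%type R) (m1 : probability X R)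
    (m2 : probability Y R) :
  (forall B, measurable B -> J (B `*` [set: Y]) = m1 B) ->
  (forall C, measurable C -> J ([set: X] `*` C) = m2 C) ->
  mutual_info J = KL J (m1 \x m2).
Proof.
move=> J1 J2; rewrite /mutual_info /KL.
rewrite (@eq_is_density _ _ _ J _ (m1 \x m2)) // => E mE.
rewrite /prodm /jointk /product_measure1.
rewrite (@eq_setfun_integral _ _ _ _ m1); last first.
  by move=> B mB; rewrite -J1// setXT.
apply: eq_integral => x _ /=.
by rewrite -J2 ?setTX//; exact: measurable_xsection.
Qed.

(** * Gibbs' inequality and its normalization condition *)

Lemma mulr_max_Nln_le1 {R : realType} (x : R) :
  (0 <= x -> Num.max (- ln x) 0 * x <= 1)%R.
Proof.
rewrite le_eqVlt => /predU1P[<-|x0]; first by rewrite mulr0.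
rewrite -ler_pdivlMr// mul1r ge_max; apply/andP; split; last first.
  by rewrite invr_ge0 ltW.
by rewrite -lnV// ltW// ln_sublinear// invr_gt0.
Qed.

(** Under [q] the integrand becomes [f] times the negative part of [ln f], which is at most 1. Only
    the positive part of a log-density can thus have an infinite integral. *)
Lemma integral_max_Nln_density_le1 {R : realType} {d : measure_display}
    {T : measurableType d} (p q : probability T R) (f : T -> R) :
  is_density p q f -> \int[p]_x (Num.max (- ln (f x)) 0)%:E <= 1.
Proof.
move=> fd; have [mf f0 pE] := fd.
have mNln : measurable_fun [set: T] (fun x => Num.max (- ln (f x)) 0)%R.
  apply: measurable_maxr => //; apply: measurableT_comp => //.
  exact: measurableT_comp.
rewrite (ge0_integral_density _ _ _ _ fd)//; last 2 first.
- exact/measurable_EFinP.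
- by move=> x; rewrite lee_fin le_max lexx orbT.
rewrite [leRHS](_ : _ = \int[q]_x cst 1 x); last first.
  by rewrite integral_cst//= mul1e probability_setT.
apply: ge0_le_integral => //.
- by move=> x _; rewrite lee_fin mulr_ge0// le_max lexx orbT.
- by apply/measurable_EFinP; exact: measurable_funM.
- by move=> x _; rewrite lee_fin mulr_max_Nln_le1.
Qed.

Lemma ln_prod {R : realType} {I : Type} (r : seq I) (a : I -> R) :
  (forall i, (0 < a i)%R) -> (ln (\prod_(i <- r) a i) = \sum_(i <- r) ln (a i))%R.
Proof.
move=> a0; elim: r => [|i r IH]; first by rewrite !big_nil ln1.
by rewrite !big_cons lnM ?posrE ?a0 ?prodr_gt0// IH.
Qed.

Lemma maxr_sub_maxrN {R : realType} (x : R) :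
  (Num.max x 0 - Num.max (- x) 0 = x)%R.
Proof.
have /orP[x0|x0] := le_total 0%R x.
  by rewrite max_l// max_r ?subr0// oppr_le0.
by rewrite max_r// max_l ?sub0r ?opprK// oppr_ge0.
Qed.

(** This is [ln u <= u - 1] at the ratio of the product to [f], with every subtracted term moved
    across so that all summands are nonnegative. *)
Lemma gibbs_pointwise {R : realType} {n : nat} (a : 'I_n -> R) (f : R) :
  (forall i, (0 < a i)%R) -> (0 < f)%R ->
  (\sum_(i < n) Num.max (ln (a i)) 0 + Num.max (- ln f) 0 + 1 <=
   Num.max (ln f) 0 + \sum_(i < n) Num.max (- ln (a i)) 0
     + (\prod_(i < n) a i) / f)%R.
Proof.
move=> a0 f0.
have G0 : (0 < \prod_(i < n) a i)%R by rewrite prodr_gt0.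
have : (ln ((\prod_(i < n) a i) / f) <= (\prod_(i < n) a i) / f - 1)%R.
  rewrite -[X in ln X](addrNK 1%R) addrC le_ln1Dx//.
  by rewrite ltrBDr addrC subrr divr_gt0.
rewrite ln_div ?posrE// ln_prod//.
rewrite -[in X in X -> _](maxr_sub_maxrN (ln f)).
under eq_bigr do rewrite -[ln _]maxr_sub_maxrN.
rewrite sumrB; move: (\sum_(i < n) _)%R (\sum_(i < n) _)%R (_ / f)%R.
by move=> s t u; lra.
Qed.

(** Integrates [gibbs_pointwise] against [J]. The absence of subtractions keeps the inequality
    meaningful when some of the integrals are infinite. *)
Lemma gibbs_integral {R : realType} {d : measure_display}
    {T : measurableType d} {n : nat} (J Q : probability T R) (f : T -> R)
    (a : 'I_n -> T -> R) : is_density J Q f ->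
  (forall i, measurable_fun [set: T] (a i)) ->
  (forall i x, (0 <= a i x)%R) ->
  (forall i, {ae J, forall x, (0 < a i x)%R}) ->
  \int[Q]_x (\prod_(i < n) a i x)%:E <= 1 ->
  \sum_(i < n) \int[J]_x (Num.max (ln (a i x)) 0)%:E
    + \int[J]_x (Num.max (- ln (f x)) 0)%:E <=
  \int[J]_x (Num.max (ln (f x)) 0)%:E
    + \sum_(i < n) \int[J]_x (Num.max (- ln (a i x)) 0)%:E.
Proof.
move=> fd ma a0 aJ intG; have [mf f0 JE] := fd.
have max0 (x : R) : 0 <= (Num.max x 0)%:E by rewrite lee_fin le_max lexx orbT.
have mpos (h : T -> R) : measurable_fun [set: T] h ->
    measurable_fun [set: T] (fun x => (Num.max (ln (h x)) 0)%:E).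
  move=> mh; apply/measurable_EFinP/measurable_maxr => //.
  exact: measurableT_comp.
have mneg (h : T -> R) : measurable_fun [set: T] h ->
    measurable_fun [set: T] (fun x => (Num.max (- ln (h x)) 0)%:E).
  move=> mh; apply/measurable_EFinP/measurable_maxr => //.
  by apply: measurableT_comp => //; exact: measurableT_comp.
(* [expR (- ln (f x))] is [(f x)^-1] where [f x > 0], and is visibly measurable. *)
pose G x := (\prod_(i < n) a i x)%R.
have G0 x : (0 <= G x)%R by apply: prodr_ge0.
have mG : measurable_fun [set: T] G by apply: measurable_prod => i _.
have mGf : measurable_fun [set: T] (fun x => (G x * expR (- ln (f x)))%:E).
  apply/measurable_EFinP/measurable_funM => //.
  apply: measurableT_comp => //; apply: measurableT_comp => //.
  exact: measurableT_comp.
have Gf0 x : 0 <= (G x * expR (- ln (f x)))%:E by rewrite lee_fin mulr_ge0// expR_ge0.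
have intGf : \int[J]_x (G x * expR (- ln (f x)))%:E <= 1.
  apply: le_trans intG; rewrite (ge0_integral_density _ _ _ _ fd)//.
  apply: ge0_le_integral => //.
  - by move=> x _; rewrite mule_ge0// lee_fin.
  - by apply: emeasurable_funM => //; exact/measurable_EFinP.
  - exact/measurable_EFinP.
  (* Multiplying by the density cancels the division by [f], except on the zero set of [f], where
     the product is 0; hence an inequality only. *)
  move=> x _; rewrite lee_fin; have [->|fx] := eqVneq (f x) 0%R.
    by rewrite mulr0 G0.
  have fx0 : (0 < f x)%R by rewrite lt_neqAle eq_sym fx f0.
  by rewrite expRN lnK ?posrE// divfK.
have msum (h : 'I_n -> T -> \bar R) : (forall i, measurable_fun [set: T] (h i)) ->
    measurable_fun [set: T] (fun x => \sum_(i < n) h i x).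
  by move=> mh; exact: emeasurable_sum.
pose pa i x := (Num.max (ln (a i x)) 0)%:E.
pose na i x := (Num.max (- ln (a i x)) 0)%:E.
pose pf x := (Num.max (ln (f x)) 0)%:E.
pose nf x := (Num.max (- ln (f x)) 0)%:E.
have mpa i : measurable_fun [set: T] (pa i) by exact: mpos.
have mna i : measurable_fun [set: T] (na i) by exact: mneg.
have mpf : measurable_fun [set: T] pf by exact: mpos.
have mnf : measurable_fun [set: T] nf by exact: mneg.
have pa0 i x : 0 <= pa i x by exact: max0.
have na0 i x : 0 <= na i x by exact: max0.
have pf0 x : 0 <= pf x by exact: max0.
have nf0 x : 0 <= nf x by exact: max0.
have spa0 x : 0 <= \sum_(i < n) pa i x by exact: sume_ge0.
have sna0 x : 0 <= \sum_(i < n) na i x by exact: sume_ge0.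
have mspa := msum _ mpa; have msna := msum _ mna.
(* The added 1 is the constant of the pointwise inequality on the left; on the right it bounds the
   integral of the ratio. *)
rewrite -(@leeD2rE _ 1)//.
apply: (@le_trans _ _ (\int[J]_x pf x + \sum_(i < n) \int[J]_x na i x
    + \int[J]_x (G x * expR (- ln (f x)))%:E)); last by rewrite leeD2l.
have -> : \sum_(i < n) \int[J]_x pa i x + \int[J]_x nf x + 1 =
    \int[J]_x (\sum_(i < n) pa i x + nf x + 1).
  rewrite ge0_integralD//; last 2 first.
  - by move=> x _; rewrite adde_ge0.
  - exact: emeasurable_funD.
  rewrite ge0_integralD// ge0_integral_sum// integral_cst//=.
  by rewrite mul1e probability_setT.
have -> : \int[J]_x pf x + \sum_(i < n) \int[J]_x na i x
      + \int[J]_x (G x * expR (- ln (f x)))%:E =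
    \int[J]_x (pf x + \sum_(i < n) na i x + (G x * expR (- ln (f x)))%:E).
  rewrite ge0_integralD//; last 2 first.
  - by move=> x _; rewrite adde_ge0.
  - exact: emeasurable_funD.
  by rewrite ge0_integralD// ge0_integral_sum.
apply: ae_ge0_le_integral => //.
- by move=> x _; rewrite !adde_ge0.
- by do 2?apply: emeasurable_funD.
- by move=> x _; rewrite !adde_ge0.
- by do 2?apply: emeasurable_funD.
have aJ' : {ae J, forall x, forall i, (0 < a i x)%R}.
  exact: filter_forall.
have fJ := ae_density_gt0 _ _ _ fd.
move: aJ' fJ; apply: filterS2 => x ax fx _.
rewrite /pa /na /pf /nf !sumEFin lee_fin expRN lnK ?posrE//.
exact: gibbs_pointwise.
Qed.

(** For [nu]-almost every [w] the function [g (w, _)] is a probability density for [mu'], so the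
    i.i.d. product formula applies with [w] fixed, and [w] is integrated last. *)
Lemma integral_prod_density_eq1 {R : realType} {dZ dW : measure_display}
    {Z : measurableType dZ} {W : measurableType dW} {n : nat}
    (mu' : probability Z R) (nu : probability W R)
    (P : probability (n.-tuple Z) R) (p : probability (W * Z)%type R)
    (g : W * Z -> R) : iid_law mu' P ->
  (forall B, measurable B -> p (B `*` [set: Z]) = nu B) ->
  is_density p (nu \x mu') g ->
  \int[P \x nu]_x (\prod_(i < n) g (x.2, tnth x.1 i))%:E = 1.
Proof.
move=> iid p1 [mg g0 pE].
have mEg : measurable_fun [set: W * Z] (EFin \o g) by exact/measurable_EFinP.
have Eg0 x : 0 <= (EFin \o g) x by rewrite /= lee_fin.
have mprod : measurable_fun [set: n.-tuple Z * W]
    (fun x => (\prod_(i < n) g (x.2, tnth x.1 i))%:E).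
  apply/measurable_EFinP/measurable_prod => i _.
  apply: measurableT_comp => //; apply: measurable_fun_pair => //=.
  exact: (measurableT_comp (@measurable_tnth _ Z n i) measurable_fst).
have prod0 (x : n.-tuple Z * W) : 0 <= (\prod_(i < n) g (x.2, tnth x.1 i))%:E.
  by rewrite lee_fin; apply: prodr_ge0.
have mF := @measurable_fun_fubini_tonelli_F _ _ _ _ _ mu' _ mEg Eg0.
(* Over any measurable [E], both functions integrate to [nu E], because the first marginal of [p] is
   [nu]. *)
have ae1 : ae_eq nu [set: W] (cst 1) (fun w => \int[mu']_z (g (w, z))%:E).
  apply: integral_ae_eq => //.
    exact: finite_measure_integrable_cst.
  move=> E _ mE; transitivity (nu E); first by rewrite integral_cst//= mul1e.
  rewrite -p1// pE; last exact: measurableX.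
  rewrite [LHS]integral_mkcond fubini_tonelli1//; last 2 first.
  - have mEZ : measurable (E `*` [set: Z]) by exact: measurableX.
    by apply: (measurable_restrictT _ mEZ).1; exact: measurable_funTS.
  - by move=> x; apply: erestrict_ge0 => y _; exact: Eg0.
  rewrite [RHS]integral_mkcond; apply: eq_integral => w _.
  rewrite /fubini_F patchE; case: ifPn => wE.
    apply: eq_integral => z _; rewrite patchE mem_set//=; split => //.
    exact: set_mem.
  rewrite integral0_eq// => z _; rewrite patchE memNset//= => -[+ _].
  by move/mem_set; rewrite (negbTE wE).
rewrite fubini_tonelli2//.
rewrite (@ge0_ae_eq_integral _ _ _ _ _ _ (cst 1))//.
- by rewrite integral_cst//= mul1e probability_setT.
- exact: measurable_fun_fubini_tonelli_G.
- by move=> w _; apply: integral_ge0 => s _; exact: (prod0 (s, w)).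
apply: filterS ae1 => w /(_ I) w1 _; rewrite /fubini_G /=.
apply: (iid_integral_prod_eq1 _ _ (fun z => g (w, z)) iid) => //.
by apply: measurableT_comp => //; exact: measurable_pair1.
Qed.

Lemma integral_lnE {R : realType} {d : measure_display} {T : measurableType d}
    (p : {measure set T -> \bar R}) (f : T -> R) :
  \int[p]_x (ln (f x))%:E =
  \int[p]_x (Num.max (ln (f x)) 0)%:E - \int[p]_x (Num.max (- ln (f x)) 0)%:E.
Proof.
rewrite integralE; congr (_ - _); apply: eq_integral => x _.
- by rewrite funeposE EFin_max.
- by rewrite funenegE EFin_max.
Qed.

(** * Marginals and mutual information of the mixture *)

Section mixture.
Context {R : realType} {dZ dW : measure_display}.
Context {Z : measurableType dZ} {W : measurableType dW}.
Variables (n : nat) (mu' : probability Z R) (nu : probability W R).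
Variables (P : probability (n.-tuple Z) R).
Variables (J : probability (n.-tuple Z * W)%type R).
Variables (p : probability (W * Z)%type R).

Let phi (i : 'I_n) (x : n.-tuple Z * W) : W * Z := (x.2, tnth x.1 i).

Hypothesis n_gt0 : (0 < n)%N.
Hypothesis P_iid : iid_law mu' P.
Hypothesis J_fst : forall B, measurable B -> J (B `*` [set: W]) = P B.
Hypothesis J_snd : forall C, measurable C -> J ([set: n.-tuple Z] `*` C) = nu C.
Hypothesis pE : forall E, p E = (n%:R^-1)%:E * \sum_(i < n) J (phi i @^-1` E).
Hypothesis p_integral : forall h : W * Z -> \bar R,
  measurable_fun [set: W * Z] h -> (forall y, 0 <= h y) ->
  \int[p]_y h y = (n%:R^-1)%:E * \sum_(i < n) \int[J]_x h (phi i x).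

Lemma measurable_coordinate_pair i :
  measurable_fun [set: n.-tuple Z * W] (fun x => (x.2, tnth x.1 i)).
Proof.
apply: measurable_fun_pair => //=.
exact: (measurableT_comp (@measurable_tnth _ Z n i) measurable_fst).
Qed.

Lemma mean_cst (x : \bar R) : (n%:R^-1)%:E * \sum_(i < n) x = x.
Proof.
have -> : \sum_(i < n) x = n%:R%:E * x.
  by rewrite big_const_ord iter_addr_0 mule_natl.
by rewrite muleA -EFinM mulVf ?mul1e// pnatr_eq0 -lt0n.
Qed.

Lemma iid_coordinate (i : 'I_n) C : measurable C ->
  P ((fun s => tnth s i) @^-1` C) = mu' C.
Proof.
move=> mC.
have := P_iid (fun j => if j == i then C else [set: Z]).
rewrite (bigD1 i)//= eqxx big1 ?mule1 => [<-|j /negbTE ->]; last 2 first.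
- by move=> j; case: ifP.
- exact: probability_setT.
congr (P _); apply/seteqP; split => s /= sC; last by have := sC i; rewrite eqxx.
by move=> j; case: eqP => // ->.
Qed.

Lemma mixture_coupling : coupling nu mu' p.
Proof.
split => [B mB|C mC]; rewrite pE.
  rewrite -[RHS]mean_cst; congr (_ * _); apply: eq_bigr => i _.
  by rewrite -J_snd// setXT setTX.
rewrite -[RHS]mean_cst; congr (_ * _); apply: eq_bigr => i _.
rewrite -(iid_coordinate i)// -J_fst; last first.
  by rewrite -[X in measurable X]setTI; exact: measurable_tnth.
by rewrite setTX setXT.
Qed.

(** A product measure is determined by rectangles, where the claim reduces to the law of one
    coordinate. It serves to transfer absolute continuity from [J] to [p]. *)
Lemma product_law_coordinate i E : measurable E ->
  (P \x nu) (phi i @^-1` E) = (nu \x mu') E.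
Proof.
move=> mE; have mphi := measurable_coordinate_pair i.
have [m mphiE] := exists_pushforward_measure (P \x nu) _ mphi.
rewrite (@product_measure_unique _ _ _ _ _ nu mu' m) ?mphiE// => A B mA mB.
have mB' : measurable ((fun s : n.-tuple Z => tnth s i) @^-1` B).
  by rewrite -[X in measurable X]setTI; exact: measurable_tnth.
have AB : phi i @^-1` (A `*` B) =
    ((fun s : n.-tuple Z => tnth s i) @^-1` B) `*` A.
  by apply/seteqP; split => x [].
transitivity ((P \x nu) (((fun s : n.-tuple Z => tnth s i) @^-1` B) `*` A)).
  by rewrite -AB.
rewrite product_measure1E//=; rewrite muleC; congr (_ * _).
exact: iid_coordinate.
Qed.

Lemma mutual_info_mixture_le : mutual_info p <= mutual_info J * (n%:R^-1)%:E.
Proof.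
have [p_fst p_snd] := mixture_coupling.
rewrite (mutual_infoE _ _ _ p_fst p_snd) (mutual_infoE _ _ _ J_fst J_snd).
have n0 : (0 < n%:R :> R)%R by rewrite ltr0n.
(* Each element of the infimum defining the divergence of [J] is bounded below; if [J] has no
   density there is nothing to bound. *)
rewrite lee_pdivlMr//; apply: le_ereal_inf_tmp => _ [f fd <-].
have [mf f0 JE] := fd.
have mphi := measurable_coordinate_pair.
have mpre i E : measurable E -> measurable (phi i @^-1` E).
  by move=> mE; rewrite -[X in measurable X]setTI; exact: mphi.
(* A null set of [nu \x mu'] pulls back along each [phi i] to a null set of [P \x nu], hence of [J];
   averaging, it is null for [p]. *)
have [|g gd] := @exists_density _ _ _ p (nu \x mu' : probability _ R).
  move=> E mE E0; rewrite [LHS]pE big1 ?mule0// => i _; rewrite JE; last exact: mpre.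
  apply: null_set_integral.
  - exact: mpre.
  - by apply/measurable_EFinP; exact: measurable_funTS.
  - by rewrite [LHS]product_law_coordinate.
have [mg g0 pgE] := gd.
apply: (@le_trans _ _ ((\int[p]_x (ln (g x))%:E) * n%:R%:E)).
  rewrite lee_wpmul2r ?lee_fin//.
  by apply: ereal_inf_lbound; exists g.
have mga i : measurable_fun [set: n.-tuple Z * W] (g \o phi i).
  by apply: measurableT_comp => //; exact: mphi.
(* A vanishing average of nonnegative masses has all terms zero, so a [p]-null set pulls back to a
   [J]-null set along every [phi i]. *)
have gJ i : {ae J, forall x, (0 < g (phi i x))%R}.
  have [N [mN N0 gN]] := ae_density_gt0 _ _ _ gd.
  exists (phi i @^-1` N); split; [exact: mpre| |by move=> x /= /gN].
  have : (n%:R^-1)%:E * \sum_(i < n) J (phi i @^-1` N) == 0 by rewrite -pE N0.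
  rewrite mule_eq0 eqe invr_eq0 (gt_eqF n0)/=.
  rewrite seq_psume_eq0// => /allP/(_ i (mem_index_enum _))/= /eqP.
  exact.
have G1 : \int[P \x nu]_x (\prod_(i < n) (g \o phi i) x)%:E <= 1.
  rewrite [leLHS](_ : _ = 1)//.
  exact: integral_prod_density_eq1 P_iid p_fst gd.
have ga0 i x : (0 <= (g \o phi i) x)%R by exact: g0.
have := gibbs_integral J (P \x nu) f (fun i => g \o phi i) fd mga ga0 gJ G1.
have max0 (x : R) : 0 <= (Num.max x 0)%:E by rewrite lee_fin le_max lexx orbT.
have sumE (h : W * Z -> \bar R) : measurable_fun [set: W * Z] h ->
    (forall y, 0 <= h y) ->
    \sum_(i < n) \int[J]_x h (phi i x) = \int[p]_y h y * n%:R%:E.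
  by move=> mh h0; rewrite p_integral// muleAC -EFinM mulVf ?gt_eqF// mul1e.
have mlng : measurable_fun [set: W * Z] (fun y => ln (g y)).
  exact: measurableT_comp.
rewrite (sumE (fun y => (Num.max (ln (g y)) 0)%:E))//; last first.
  by apply/measurable_EFinP/measurable_maxr.
rewrite (sumE (fun y => (Num.max (- ln (g y)) 0)%:E))//; last first.
  by apply/measurable_EFinP/measurable_maxr => //; exact: measurableT_comp.
rewrite !integral_lnE.
have negfin d (T : measurableType d) (q q' : probability T R) (h : T -> R) :
    is_density q q' h -> \int[q]_x (Num.max (- ln (h x)) 0)%:E \is a fin_num.
  move=> hd; rewrite ge0_fin_numE; last by apply: integral_ge0 => x _.
  by rewrite (le_lt_trans (integral_max_Nln_density_le1 _ _ _ hd))// ltry.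
have gfin := negfin _ _ p (nu \x mu') g gd.
have ffin := negfin _ _ J (P \x nu) f fd.
(* The negative parts are finite, so they can be moved back to recover the two divergence
   integrals. *)
move=> H; rewrite muleBl//; last first.
  by rewrite fin_num_adde_defl// fin_numN.
rewrite leeBlDr ?fin_numM// addeAC leeBrDr//.
Qed.

End mixture.

(** * The lower bound on the generalization gap *)

Lemma ge0_integrable {R : realType} {d : measure_display}
    {T : measurableType d} (m : {measure set T -> \bar R}) (h : T -> \bar R) :
  measurable_fun [set: T] h -> (forall x, 0 <= h x) ->
  \int[m]_x h x < +oo -> m.-integrable [set: T] h.
Proof.
move=> mh h0 hoo; apply/integrableP; split => //.
by under eq_integral do rewrite gee0_abs//.
Qed.

Theorem theorem7 (R : realType) (dZ dW : measure_display)
  (Z : measurableType dZ) (W : measurableType dW)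
  (M : set (probability W R))
  (l : W -> Z -> R)
  (l_ge0 : forall w z, (0 <= l w z)%R)
  (l_meas : measurable_fun [set: W * Z] (fun p => l p.1 p.2))
  (mu mu' : probability Z R) (n : nat) (n_gt0 : (0 < n)%N)
  (P : probability (n.-tuple Z) R) (P_iid : iid_law mu' P)
  (A : R.-pker (n.-tuple Z) ~> W)
  (A_marg_in_M : exists2 nu : probability W R, M nu &
      forall B, measurable B -> nu B = out_law P A B)
  (fin_pop : \int[train_joint P A]_p pop_risk l mu p.2 < +oo)
  (fin_emp : \int[train_joint P A]_p (emp_risk l p.1 p.2)%:E < +oo) :
  gen l mu P A >=
    D4 l mu mu' (mutual_info (train_joint P A) * (n%:R^-1)%:E) M.
Proof.
have [nu Mnu nuE] := A_marg_in_M.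
have [J JE] := jointk_probability P A.
have J_fst B : measurable B -> J (B `*` [set: W]) = P B.
  move=> mB; rewrite JE /jointk.
  rewrite (eq_integral (fun s => (\1_B s)%:E)); last first.
    move=> s _; rewrite indicE; have [sB|sB] := boolP (s \in B).
      by rewrite in_xsectionX// prob_kernel.
    by rewrite notin_xsectionX// measure0.
  by rewrite integral_indic// setIT.
have J_snd C : measurable C -> J ([set: n.-tuple Z] `*` C) = nu C.
  move=> mC; rewrite JE nuE//; apply: eq_integral => s _.
  by rewrite in_xsectionX// in_setT.
have mphi := @measurable_coordinate_pair _ _ Z W n.
have [p pE p_int] := uniform_mixture_pushforward J _ n_gt0 mphi.
have mL : measurable_fun [set: W] (pop_risk l mu).
  apply: (@measurable_fun_fubini_tonelli_F _ _ _ _ _ mu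
    (fun y : W * Z => (l y.1 y.2)%:E)); first exact/measurable_EFinP.
  by move=> y; rewrite lee_fin.
have L0 w : 0 <= pop_risk l mu w.
  by apply: integral_ge0 => z _; rewrite lee_fin.
have mlE : measurable_fun [set: W * Z] (fun y => (l y.1 y.2)%:E).
  exact/measurable_EFinP.
have mli i : measurable_fun [set: n.-tuple Z * W]
    (fun x => (l x.2 (tnth x.1 i))%:E).
  exact: (measurableT_comp mlE (mphi i)).
have lE0 y z : 0 <= (l y z)%:E by rewrite lee_fin.
have empE (x : n.-tuple Z * W) : (emp_risk l x.1 x.2)%:E =
    (n%:R^-1)%:E * \sum_(i < n) (l x.2 (tnth x.1 i))%:E.
  by rewrite /emp_risk EFinM sumEFin.
have memp : measurable_fun [set: n.-tuple Z * W]
    (fun x => (emp_risk l x.1 x.2)%:E).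
  under eq_fun do rewrite empE.
  exact/measurable_funeM/emeasurable_sum.
have emp0 (x : n.-tuple Z * W) : 0 <= (emp_risk l x.1 x.2)%:E.
  by rewrite empE mule_ge0 ?lee_fin ?invr_ge0// sume_ge0.
have mL1 : measurable_fun [set: W * Z] (fun y => pop_risk l mu y.1).
  exact: measurableT_comp.
(* Every component of the mixture has the same first coordinate, so the average over [i] is
   constant. *)
have intL : \int[p]_y pop_risk l mu y.1 = \int[J]_x pop_risk l mu x.2.
  by rewrite (p_int (fun y => pop_risk l mu y.1))//=; exact: mean_cst.
have intl : \int[p]_y (l y.1 y.2)%:E = \int[J]_x (emp_risk l x.1 x.2)%:E.
  rewrite p_int//=; under [RHS]eq_integral do rewrite empE.
  rewrite ge0_integralZl ?lee_fin ?invr_ge0//; last 2 first.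
  - exact: emeasurable_sum.
  - by move=> x _; rewrite sume_ge0.
  by rewrite ge0_integral_sum.
move: fin_pop fin_emp; rewrite /gen /train_joint -JE => fin_pop fin_emp.
(* The pair [nu], [p] is feasible in [D4], and its objective value is exactly the generalization
   gap. *)
apply: ereal_inf_lbound; exists nu, p; split => //.
- exact: (mixture_coupling _ _ _ P J).
- exact: (mutual_info_mixture_le _ mu' nu P).
(* Splitting the difference is legitimate because [intL] and [intl] carry the finiteness assumptions
   over to [p]. *)
have -> : \int[p]_y (pop_risk l mu y.1 - (l y.1 y.2)%:E) =
    \int[p]_y pop_risk l mu y.1 - \int[p]_y (l y.1 y.2)%:E.
  apply: integralB => //; apply: ge0_integrable => //.
  - by rewrite intL.
  - by rewrite intl.
rewrite intL intl; apply: integralB => //; apply: ge0_integrable => //.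
exact: measurableT_comp.
Qed.
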